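(* For every $c>0$ there exists $K_c>0$ such that for every $n$ the following holds. If $\mathcal{A}\subset S_n$ has no singleton intersection and $|\mathcal{A}|\ge c(n-2)!$, then there exist $i,j,k,l\in[n]$ with $i\ne k$, $j\ne l$ such that $$|\mathcal{A}\setminus\mathcal{A}_{i\mapsto j,k\mapsto l}|\le K_c(n-3)!.$$
   Context: $\mathcal{A}\subset S_n$ has no singleton intersection if no two permutations in $\mathcal{A}$ agree at exactly one point, i.e. there are no $\sigma,\tau\in\mathcal{A}$ with $\#\{i:\sigma(i)=\tau(i)\}=1$. For distinct $i_1,\dots,i_l$ and distinct $j_1,\dots,j_l$, $\mathcal{A}_{i_1\mapsto j_1,\dots,i_l\mapsto j_l}=\{\sigma\in\mathcal{A}:\sigma(i_k)=j_k\ \forall k\}$. *)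

(* Defs.v *)
From HB Require Import structures.
From mathcomp Require Import all_boot all_order all_algebra all_fingroup.
Set Implicit Arguments. Unset Strict Implicit. Unset Printing Implicit Defensive.

Definition agree n (s t : 'S_n) : nat := #|[set i : 'I_n | s i == t i]|.

Definition no_singleton_intersection n (A : {set 'S_n}) : Prop :=
  forall s t, s \in A -> t \in A -> agree s t <> 1%N.

Definition fix2 n (A : {set 'S_n}) (i j k l : 'I_n) : {set 'S_n} :=
  [set s in A | (s i == j) && (s k == l)].

(* Main.v *)
(* Identify a permutation with its graph, an n-subset of [n] x [n].  Call a
   family spread over a partial permutation S if fixing up to four further
   values shrinks it by a factor at least r per value, with r close to n.  For
   two such families over S and T, of size O(log n), the first four factorial
   moments of the number of agreements outside S and T of a random pair are
   close to 1/j!: the upper bound is direct, and the lower bound follows from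
   (a - x)(b - y) >= 0 applied to the link sizes x <= a and y <= b.  By
   Bonferroni, this number is 0, and likewise 1, with probability bounded below,
   so if A has no singleton intersection then S and T share at least two pairs.

   Maximising a discounted link density, starting from the permutations of A
   that extend no such S, shows that at most (n-3)! permutations escape these
   S.  Either all S contain a common pair of cells, which gives the 2-coset, or
   every S contains one of O(log^3 n) fixed triples; the latter gives
   |A| = O(log^3 n) (n-3)!, which is below c (n-2)! for large n. *)
Require Import Defs.
From HB Require Import structures.
From mathcomp Require Import all_boot all_order all_algebra all_fingroup.
From mathcomp Require Import zify ring lra.
Import Order.TTheory GRing.Theory Num.Theory.
Local Open Scope ring_scope.
Set Implicit Arguments. Unset Strict Implicit. Unset Printing Implicit Defensive.

(** * Falling factorials, growth estimates and Bonferroni inequalities *)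

Lemma ffact_le_exp n j : (n ^_ j <= n ^ j)%N.
Proof.
by elim: j => // j IH; rewrite ffactnSr expnSr leq_mul ?leq_subr.
Qed.

Lemma ffact_ge_exp n j : ((n - j) ^ j <= n ^_ j)%N.
Proof.
elim: j => // j IH; rewrite ffactnSr expnSr leq_mul ?leq_sub2l //.
by apply: leq_trans IH; case: j => // j; rewrite leq_exp2r // leq_sub2l.
Qed.

Lemma ffactnD n i j : n ^_ (i + j) = (n ^_ i * (n - i) ^_ j)%N.
Proof.
elim: j => [|j IH]; first by rewrite addn0 ffactn0 muln1.
by rewrite addnS !ffactnSr IH mulnA subnDA.
Qed.

Lemma exp2_dominates_cube C :
  exists L0, forall L, (L0 <= L)%N -> (C * (L + 1) ^ 3 <= 2 ^ L)%N.
Proof.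
(* [2 ^ L] is at least [w ^ 4]: three factors [w] absorb [(L + 1) ^ 3] up to [9 ^ 3], and the fourth
   absorbs [C * 9 ^ 3]. *)
exists (4 * (C * 9 ^ 3 + 1))%N => L hL.
set w := (L %/ 4)%N.
have hw : (C * 9 ^ 3 + 1 <= w)%N by rewrite leq_divRL // mulnC.
have Lw : (L + 1 <= 9 * w)%N by rewrite /w in hw *; lia.
apply: (@leq_trans (w ^ 4)); last first.
  apply: (@leq_trans ((2 ^ w) ^ 4)).
    by rewrite leq_exp2r // ltnW // ltn_expl.
  by rewrite -expnM leq_exp2l // /w leq_trunc_div.
apply: (@leq_trans (C * (9 * w) ^ 3)); first by rewrite leq_mul2l leq_exp2r // Lw orbT.
rewrite expnMn mulnA [(w ^ 4)%N]expnS leq_mul2r; apply/orP; right; lia.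
Qed.

Lemma cube_le_of_log C :
  exists n0, forall n, (n0 <= n)%N -> (C * (trunc_log 2 n + 1) ^ 3 <= n)%N.
Proof.
have [L0 hL0] := exp2_dominates_cube C.
exists (2 ^ L0)%N => n hn.
have n_gt0 : (0 < n)%N by apply: leq_trans hn; rewrite expn_gt0.
apply: (@leq_trans (2 ^ trunc_log 2 n)); last exact: trunc_logP.
by apply: hL0; apply: trunc_log_max.
Qed.

Lemma bernoulli (R : realFieldType) (x : R) k : 0 <= x -> 1 + k%:R * x <= (1 + x) ^+ k.
Proof.
move=> x0; elim: k => [|k IH]; first by rewrite mul0r addr0.
rewrite exprS mulrS; have k0 : 0 <= k%:R * x * x by rewrite !mulr_ge0.
have := ler_wpM2l (_ : 0 <= 1 + x) IH; rewrite addr_ge0 // => /(_ isT); lra.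
Qed.

(** By Bernoulli the 100th power of 101/100 is at least 2, so the exponent
    [300 * (trunc_log 2 n + 1)] already pushes the power past [n ^ 3]. *)
Lemma leq_of_growth (R : realFieldType) n k :
  (101%:R / 100%:R) ^+ k <= n%:R ^+ 3 :> R -> (k <= 300 * (trunc_log 2 n + 1))%N.
Proof.
move=> hk; rewrite leqNgt; apply/negP => /ltnW qk.
have a1 : 1 <= 101%:R / 100%:R :> R by lra.
have two : 2 <= (101%:R / 100%:R) ^+ 100 :> R.
  have x0 : 0 <= 100%:R^-1 :> R by rewrite invr_ge0.
  have := bernoulli 100 x0; rewrite mulfV ?pnatr_eq0 //.
  by rewrite (_ : 1 + 100%:R^-1 = 101%:R / 100%:R); last lra.
have : n%:R ^+ 3 < (101%:R / 100%:R) ^+ k :> R.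
  apply: lt_le_trans (ler_weXn2l a1 qk).
  rewrite (_ : 300 * _ = 100 * (3 * (trunc_log 2 n + 1)))%N; last by lia.
  rewrite exprM; apply: lt_le_trans (_ : 2 ^+ (3 * (trunc_log 2 n + 1)) <= _).
    rewrite -!natrX ltr_nat mulnC expnM ltn_exp2r // addn1.
    exact: trunc_log_ltn.
  by apply: lerXn2r; rewrite // nnegrE ?(le_trans _ two).
by rewrite ltNge hk.
Qed.

(** The truncation [N = 0] >= 1 - C(N,1) + C(N,2) - C(N,3), in falling factorials and without
    subtraction. *)
Lemma bonferroni0 (R : realFieldType) N :
  1 + ('C(N, 2) * 2`!)%:R / 2 <=
    (N == 0%N)%:R + ('C(N, 1) * 1`!)%:R + ('C(N, 3) * 3`!)%:R / 6 :> R.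
Proof.
rewrite !bin_ffact; case: N => [|[|[|k]]]; rewrite ?ffactE /=; try lra.
rewrite !natrM -(addn3 k) -(addn2 k) -(addn1 k) !natrD; have : 0 <= k%:R :> R by [].
move: (k%:R) => x x0; have x2 := mulr_ge0 x0 x0; have x3 := mulr_ge0 x0 x2.
by have x4 := mulr_ge0 x0 x3; rewrite /=; lra.
Qed.

(** Likewise [N = 1] >= C(N,1) - 2 C(N,2) + 3 C(N,3) - 4 C(N,4). *)
Lemma bonferroni1 (R : realFieldType) N :
  ('C(N, 1) * 1`!)%:R + ('C(N, 3) * 3`!)%:R / 2 <=
    (N == 1%N)%:R + ('C(N, 2) * 2`!)%:R + ('C(N, 4) * 4`!)%:R / 6 :> R.
Proof.
rewrite !bin_ffact; case: N => [|[|[|[|k]]]]; rewrite ?ffactE /=; try lra.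
rewrite !natrM -(addn4 k) -(addn3 k) -(addn2 k) -(addn1 k) !natrD; have : 0 <= k%:R :> R by [].
move: (k%:R) => x x0; have x2 := mulr_ge0 x0 x0; have x3 := mulr_ge0 x0 x2.
by have x4 := mulr_ge0 x0 x3; rewrite /=; lra.
Qed.

(** * Spread set families and moments of their intersections *)

Section SetFamilies.

Variables (I U : finType) (g : I -> {set U}).
Implicit Types (A B : {set I}) (S T W X : {set U}).

Definition link (A : {set I}) (X : {set U}) : {set I} :=
  [set s in A | X \subset g s].


Lemma bin_card_setI (Y W : {set U}) j :
  'C(#|Y :&: W|, j) =
    (\sum_(X : {set U} | (X \subset W) && (#|X| == j)) (X \subset Y))%N.
Proof.
rewrite -cards_draws -sum1dep_card big_mkcond [RHS]big_mkcond /=.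
apply: eq_bigr => X _; rewrite subsetI.
by case: (X \subset Y); case: (X \subset W); case: (#|X| == j).
Qed.

Lemma card_link A X : #|link A X| = (\sum_(s in A) (X \subset g s))%N.
Proof.
rewrite -sum1dep_card big_mkcondr /=; apply: eq_bigr => s _; by case: ifP.
Qed.

Lemma sum_bin_card A W j :
  (\sum_(s in A) 'C(#|g s :&: W|, j) =
   \sum_(X : {set U} | (X \subset W) && (#|X| == j)) #|link A X|)%N.
Proof.
under eq_bigr => s _ do rewrite bin_card_setI.
by rewrite exchange_big /=; apply: eq_bigr => X _; rewrite card_link.
Qed.

(** Double counting of triples [(s, t, X)]: moments of intersection sizes become sums of products of
    link sizes. *)
Lemma sum2_bin_card A B W j :
  (\sum_(s in A) \sum_(t in B) 'C(#|g s :&: g t :&: W|, j) =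
   \sum_(X : {set U} | (X \subset W) && (#|X| == j)) #|link A X| * #|link B X|)%N.
Proof.
under eq_bigr => s _ do
  (under eq_bigr => t _ do rewrite bin_card_setI; rewrite exchange_big /=).
rewrite exchange_big /=; apply: eq_bigr => X _.
rewrite !card_link big_distrl /=; apply: eq_bigr => s _.
rewrite big_distrr /=; apply: eq_bigr => t _.
by rewrite subsetI -mulnb.
Qed.


Variable R : realFieldType.
Implicit Types (r b : R).

(** [X] avoids [S] because all members may contain [S]; 4 is the highest factorial moment used. *)
Definition spread r A S : bool :=
  [forall X : {set U}, [disjoint X & S] && (#|X| <= 4)%N ==>
    (#|link A X|%:R * r ^+ #|X| <= #|A|%:R)].

Lemma spreadP r A S X : spread r A S -> [disjoint X & S] -> (#|X| <= 4)%N ->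
  #|link A X|%:R * r ^+ #|X| <= #|A|%:R.
Proof. by move=> /forallP/(_ X)/implyP H dX cX; apply: H; rewrite dX. Qed.

(** Spreadness bounds each link of [B]; the remaining sum over [A] counts [j]-subsets of [n]-sets,
    and [n%:R <= b * r] turns the quotient into [b ^+ j]. *)
Lemma moment_upper r b n A B S T j :
    0 < r -> n%:R <= b * r -> (j <= 4)%N ->
    (forall s, s \in A -> #|g s| = n) -> spread r B T ->
  (\sum_(s in A) \sum_(t in B) 'C(#|g s :&: g t :&: ~: (S :|: T)|, j))%:R
    * j`!%:R <= #|A|%:R * #|B|%:R * b ^+ j.
Proof.
move=> r0 nb j4 gn sB; rewrite sum2_bin_card.
set W := ~: (S :|: T); set E := (\sum_(_ | _) _)%N.
have rj0 : 0 < r ^+ j by rewrite exprn_gt0.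
have H1 : E%:R * r ^+ j <= #|B|%:R * (\sum_(s in A) 'C(#|g s :&: W|, j))%:R.
  rewrite sum_bin_card /E !natr_sum mulr_sumr mulr_suml ler_sum // => X.
  case/andP=> XW /eqP cX; rewrite natrM -mulrA mulrC ler_wpM2r //.
  rewrite -cX; apply: spreadP sB _ _; last by rewrite cX.
  apply: disjointWl XW _; rewrite disjoint_sym disjoints_subset setCK.
  exact: subsetUr.
have H2 : (\sum_(s in A) 'C(#|g s :&: W|, j))%:R * j`!%:R
    <= #|A|%:R * (b ^+ j * r ^+ j) :> R.
  rewrite natr_sum mulr_suml mulr_natl -sumr_const ler_sum // => s sA.
  rewrite -natrM bin_ffact -exprMn.
  apply: (@le_trans _ _ (n%:R ^+ j)).
    rewrite -natrX ler_nat (leq_trans (ffact_le_exp _ _)) //.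
    case: j {H1 E j4 rj0} => // j.
    by rewrite leq_exp2r // -(gn s sA) subset_leq_card // subsetIl.
  by apply: lerXn2r; rewrite ?nnegrE // (le_trans _ nb).
rewrite -(ler_pM2r rj0) mulrAC.
apply: le_trans (ler_wpM2r _ H1) _ => //.
rewrite -[leLHS]mulrA; apply: le_trans (ler_wpM2l _ H2) _ => //.
by rewrite le_eqVlt; apply/orP; left; apply/eqP; ring.
Qed.

(* With [x <= a] and [y <= b], the inequality [0 <= (a - x) * (b - y)] bounds
   the sum of the products [x * y] from below by the first moments. *)
Lemma moment_lower r b n A B S T j :
    0 < r -> n%:R <= b * r -> (j <= 4)%N -> (#|U| <= n ^ 2)%N ->
    (forall s, s \in A -> r <= (#|g s :&: ~: (S :|: T)| - j)%:R) ->
    (forall t, t \in B -> r <= (#|g t :&: ~: (S :|: T)| - j)%:R) ->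
    spread r A S -> spread r B T ->
  #|A|%:R * #|B|%:R * (2 - b ^+ (2 * j)) <=
  (\sum_(s in A) \sum_(t in B) 'C(#|g s :&: g t :&: ~: (S :|: T)|, j))%:R
    * j`!%:R.
Proof.
move=> r0 nb j4 Un gA gB sA sB; rewrite sum2_bin_card.
set W := ~: (S :|: T) in gA gB *; set E := (\sum_(_ | _) _)%N.
have rj0 : 0 < r ^+ j by rewrite exprn_gt0.
have first (D : {set I}) : (forall s, s \in D -> r <= (#|g s :&: W| - j)%:R) ->
    #|D|%:R * r ^+ j <= (\sum_(s in D) 'C(#|g s :&: W|, j))%:R * j`!%:R.
  move=> gD; rewrite natr_sum mulr_suml mulr_natl -sumr_const ler_sum // => s sD.
  rewrite -natrM bin_ffact; apply: (@le_trans _ _ ((#|g s :&: W| - j)%:R ^+ j)).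
    by apply: lerXn2r; rewrite ?nnegrE ?(ltW r0) // gD.
  by rewrite -natrX ler_nat ffact_ge_exp.
have FA := first A gA; have FB := first B gB.
(* The number of sets [X] accounts for the loss [b ^+ (2 * j)]; [FA] and [FB] each contribute 1 to
   the 2. *)
have CW : 'C(#|W|, j)%:R * j`!%:R <= b ^+ (2 * j) * (r ^+ j * r ^+ j).
  rewrite -natrM bin_ffact -exprD addnn -mul2n -exprMn.
  apply: (@le_trans _ _ (n%:R ^+ (2 * j))).
    rewrite -natrX ler_nat (leq_trans (ffact_le_exp _ _)) // expnM.
    case: j {E j4 rj0 first gA gB FA FB} => // j.
    by rewrite leq_exp2r // (leq_trans _ Un) // max_card.
  by apply: lerXn2r; rewrite ?nnegrE // (le_trans _ nb).
have H1 : #|A|%:R * (r ^+ j * (\sum_(t in B) 'C(#|g t :&: W|, j))%:R)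
    + #|B|%:R * (r ^+ j * (\sum_(s in A) 'C(#|g s :&: W|, j))%:R)
    - #|A|%:R * #|B|%:R * 'C(#|W|, j)%:R <= E%:R * (r ^+ j * r ^+ j) :> R.
  rewrite !sum_bin_card -cards_draws -sum1dep_card /E !natr_sum.
  rewrite !mulr_sumr mulr_suml -big_split /= -sumrB ler_sum // => X.
  case/andP=> XW /eqP cX; rewrite natrM.
  have dS : [disjoint X & S].
    by rewrite (disjointWl XW) // disjoint_sym disjoints_subset setCK subsetUl.
  have dT : [disjoint X & T].
    by rewrite (disjointWl XW) // disjoint_sym disjoints_subset setCK subsetUr.
  have := spreadP sA dS; have := spreadP sB dT; rewrite cX => /(_ j4) hB /(_ j4) hA.
  have : 0 <= (#|A|%:R - #|link A X|%:R * r ^+ j)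
            * (#|B|%:R - #|link B X|%:R * r ^+ j).
    by rewrite mulr_ge0 // subr_ge0.
  by move: (r ^+ j) => z; nra.
have rr0 : 0 < r ^+ j * r ^+ j by rewrite mulr_gt0.
rewrite -(ler_pM2r rr0) [leRHS]mulrAC.
apply: le_trans (ler_wpM2r _ H1) => //.
have := ler_wpM2l (mulr_ge0 (ler0n R #|A|) (ltW rj0)) FB.
have := ler_wpM2l (mulr_ge0 (ler0n R #|B|) (ltW rj0)) FA.
have := ler_wpM2l (mulr_ge0 (ler0n R #|A|) (ler0n R #|B|)) CW.
lra.
Qed.

(** Union bound: each element of [W] lies in at most a fraction 1/r of the members. *)
Lemma first_moment r A S W : spread r A S -> [disjoint W & S] ->
  (\sum_(s in A) #|g s :&: W|)%:R * r <= #|W|%:R * #|A|%:R.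
Proof.
move=> sA dW; under eq_bigr => s _ do rewrite -(bin1 #|g s :&: W|).
rewrite sum_bin_card natr_sum mulr_suml.
rewrite -(bin1 #|W|) -cards_draws -sum1dep_card natr_sum mulr_suml.
rewrite ler_sum // => X /andP[XW /eqP cX].
by rewrite mul1r -(expr1 r) -cX; apply: spreadP sA _ _; rewrite ?cX ?(disjointWl XW).
Qed.

(** If [g t] misses [S :\: T] and [g s] misses [T :\: S], the agreements inside [S :|: T] are
    exactly [S :&: T]; then [1 - #|S :&: T|] further ones would make a single agreement in total. *)
Lemma card_agreements s t S T : S \subset g s -> T \subset g t ->
    (#|S :&: T| <= 1)%N -> #|g s :&: g t| <> 1%N ->
  ((#|g s :&: g t :&: ~: (S :|: T)| == 1 - #|S :&: T|)
    <= #|g t :&: (S :\: T)| + #|g s :&: (T :\: S)|)%N.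
Proof.
move=> Ss Tt d1 ne1; case: eqP => //= hN; rewrite lt0n; apply/eqP => /eqP.
rewrite addn_eq0 !cards_eq0 => /andP[/eqP e1 /eqP e2]; apply: ne1.
have ST : g s :&: g t :&: (S :|: T) = S :&: T.
  apply/setP => x; rewrite !inE.
  have := subsetP Ss x; have := subsetP Tt x.
  move/setP/(_ x): e1; move/setP/(_ x): e2; rewrite !inE.
  by do 4 case: (x \in _) => //=; move=> _ _ h1 h2; rewrite ?h1 ?h2.
by rewrite -(cardsID (S :|: T)) ST setDE hN; lia.
Qed.

(** Otherwise [card_agreements] bounds the probability of [1 - #|S :&: T|] outside agreements by the
    mean of [e], at most 1/20, whereas Bonferroni makes it larger. *)
Lemma spread_meet_once r b n q A B S T :
    0 < r -> n%:R <= b * r -> b <= 103%:R / 100%:R -> (#|U| <= n ^ 2)%N ->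
    r <= (n - q - 4)%:R -> q%:R * 20%:R <= r ->
    (#|S| + #|T| <= q)%N ->
    (forall s, s \in A -> #|g s| = n) -> (forall t, t \in B -> #|g t| = n) ->
    (forall s, s \in A -> S \subset g s) -> (forall t, t \in B -> T \subset g t) ->
    A != set0 -> B != set0 -> spread r A S -> spread r B T ->
    (#|S :&: T| <= 1)%N ->
  exists s t, [/\ s \in A, t \in B & #|g s :&: g t| = 1%N].
Proof.
move=> r0 nb b1 Un rn qr cST gA gB SA TB A0 B0 sA sB d1.
case: (boolP [exists s in A, exists t in B, #|g s :&: g t| == 1%N]).
  by case/exists_inP => s sA' /exists_inP[t tB' /eqP h]; exists s, t.
rewrite negb_exists_in => /forall_inP H; exfalso.
have {}H s t : s \in A -> t \in B -> #|g s :&: g t| <> 1%N.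
  move=> sA' tB' /eqP h; have /negP := H s sA'; apply.
  by apply/exists_inP; exists t.
pose sum2 (h : I -> I -> R) := \sum_(s in A) \sum_(t in B) h s t.
have sum2D h1 h2 : sum2 (fun s t => h1 s t + h2 s t) = sum2 h1 + sum2 h2.
  by rewrite /sum2 -big_split; apply: eq_bigr => s _; rewrite -big_split.
have sum2Z h x : sum2 (fun s t => h s t * x) = sum2 h * x.
  by rewrite /sum2 mulr_suml; apply: eq_bigr => s _; rewrite mulr_suml.
have sum2c x : sum2 (fun _ _ => x) = #|A|%:R * #|B|%:R * x.
  by rewrite /sum2 !sumr_const -mulrnA mulnC -natrM mulr_natl.
have le_sum2 h1 h2 :
    (forall s t, s \in A -> t \in B -> h1 s t <= h2 s t) -> sum2 h1 <= sum2 h2.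
  by move=> h; apply: ler_sum => s ?; apply: ler_sum => t ?; apply: h.
pose N s t := #|g s :&: g t :&: ~: (S :|: T)|.
pose e s t := (#|g t :&: (S :\: T)| + #|g s :&: (T :\: S)|)%N.
(* [F j] is a falling factorial of [N], so [sum2 (F j)] is an unnormalised factorial moment. *)
pose F j s t : R := ('C(N s t, j) * j`!)%:R.
have FE j : sum2 (F j) = (\sum_(s in A) \sum_(t in B) 'C(N s t, j))%:R * j`!%:R.
  rewrite natr_sum mulr_suml; apply: eq_bigr => s _.
  by rewrite natr_sum mulr_suml; apply: eq_bigr => t _; rewrite /F natrM.
have up j : (j <= 4)%N -> sum2 (F j) <= #|A|%:R * #|B|%:R * b ^+ j.
  by move=> j4; rewrite FE; apply: moment_upper nb j4 gA sB.
have cW D : (forall s, s \in D -> #|g s| = n) -> forall j, (j <= 4)%N ->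
    forall s, s \in D -> r <= (#|g s :&: ~: (S :|: T)| - j)%:R.
  move=> gD j j4 s sD; apply: le_trans rn _; rewrite ler_nat.
  have := cardsID (S :|: T) (g s); rewrite setDE gD //.
  have := subset_leq_card (subsetIr (g s) (S :|: T)).
  have := (leq_card_setU S T).1; lia.
have low j : (j <= 4)%N ->
    #|A|%:R * #|B|%:R * (2 - b ^+ (2 * j)) <= sum2 (F j).
  move=> j4; rewrite FE; apply: (moment_lower r0 nb j4 Un _ _ sA sB).
    exact: cW gA _ j4.
  exact: cW gB _ j4.
have ab0 : 0 < #|A|%:R * #|B|%:R :> R.
  by rewrite mulr_gt0 // ltr0n card_gt0.
have bad : sum2 (fun s t => (e s t)%:R) <= #|A|%:R * #|B|%:R / 20%:R.
  have dB : [disjoint S :\: T & T] by rewrite disjoints_subset setDE subsetIr.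
  have dA : [disjoint T :\: S & S] by rewrite disjoints_subset setDE subsetIr.
  have := first_moment sA dA; have := first_moment sB dB.
  set x := (\sum_(t in B) _)%N; set y := (\sum_(s in A) _)%N => hx hy.
  have -> : sum2 (fun s t => (e s t)%:R) = #|A|%:R * x%:R + #|B|%:R * y%:R.
    under [LHS]eq_bigr => s _ do rewrite -natr_sum big_split sum_nat_const.
    by rewrite -natr_sum big_split /= sum_nat_const -big_distrr /= natrD !natrM.
  have cD : #|S :\: T|%:R + #|T :\: S|%:R <= q%:R :> R.
    rewrite -natrD ler_nat (leq_trans _ cST) // leq_add //;
      by rewrite subset_leq_card // subsetDl.
  have := ler_wpM2l (ler0n R #|A|) hx; have := ler_wpM2l (ler0n R #|B|) hy.
  have := ler_wpM2l (ltW ab0) cD; have := ler_wpM2l (ltW ab0) qr => h1 h2 h3 h4.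
  by rewrite -(ler_pM2r r0); lra.
have le_e s t : s \in A -> t \in B ->
    (N s t == 1 - #|S :&: T|)%N%:R <= (e s t)%:R :> R.
  move=> sA' tB'; rewrite ler_nat; apply: card_agreements; auto.
have b0 : 0 <= b by rewrite -(pmulr_lge0 _ r0) (le_trans _ nb).
set m := _ * _ in ab0 bad up low sum2c.
have bX j x : (103%:R / 100%:R) ^+ j <= x -> m * b ^+ j <= m * x.
  move=> jx; apply: ler_wpM2l; first exact: ltW.
  by apply: le_trans jx; apply: lerXn2r; rewrite // nnegrE ?divr_ge0.
have [d0|d0] : #|S :&: T| = 0%N \/ #|S :&: T| = 1%N.
  by move: d1; case: #|S :&: T| => [|[|?]] // _; [left|right].
(* One outside agreement has probability at least 0.93 - 1.07 + 0.805/2 - 1.13/6 > 0.07. *)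
- rewrite d0 subn0 in le_e.
  have : sum2 (fun s t => F 1%N s t + F 3 s t * 2^-1)
      <= sum2 (fun s t => (e s t)%:R + F 2 s t + F 4 s t * 6^-1).
    apply: le_sum2 => s t sA' tB'; apply: le_trans (bonferroni1 R (N s t)) _.
    by rewrite !lerD2r le_e.
  have : m * b ^+ 2 <= m * (107%:R / 100%:R) by apply: bX; rewrite !exprS expr0; lra.
  have : m * b ^+ 4 <= m * (113%:R / 100%:R) by apply: bX; rewrite !exprS expr0; lra.
  have : m * b ^+ 6 <= m * (1195%:R / 1000%:R) by apply: bX; rewrite !exprS expr0; lra.
  have := low 1%N isT; have := low 3 isT; have := up 2 isT; have := up 4 isT.
  rewrite !sum2D !sum2Z -[(2 * 1)%N]/2%N -[(2 * 3)%N]/6%N !mulrBr; lra.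
(* No outside agreement has probability at least 1 - 1.03 + 0.87/2 - 1.10/6 > 0.2. *)
- rewrite d0 subnn in le_e.
  have : sum2 (fun s t => 1 + F 2 s t * 2^-1)
      <= sum2 (fun s t => (e s t)%:R + F 1%N s t + F 3 s t * 6^-1).
    apply: le_sum2 => s t sA' tB'; apply: le_trans (bonferroni0 R (N s t)) _.
    by rewrite !lerD2r le_e.
  have : m * b ^+ 1 <= m * (103%:R / 100%:R) by apply: bX; rewrite !exprS expr0; lra.
  have : m * b ^+ 3 <= m * (110%:R / 100%:R) by apply: bX; rewrite !exprS expr0; lra.
  have : m * b ^+ 4 <= m * (113%:R / 100%:R) by apply: bX; rewrite !exprS expr0; lra.
  have := low 2 isT; have := up 1%N isT; have := up 3 isT.
  rewrite !sum2D !sum2Z sum2c -[(2 * 2)%N]/4%N !mulrBr; lra.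
Qed.

End SetFamilies.

Lemma leq_card_bigcup (I T : finType) (P : {set I}) (F : I -> {set T}) k :
  (forall i, i \in P -> (#|F i| <= k)%N) -> (#|\bigcup_(i in P) F i| <= #|P| * k)%N.
Proof.
move=> h; rewrite -sum_nat_const.
apply: (big_ind2 (fun (X : {set T}) m => #|X| <= m)%N) => [|X m Y p hX hY|] //.
  by rewrite cards0.
by apply: leq_trans (leq_card_setU X Y).1 _; apply: leq_add.
Qed.

(** * Permutations as graphs, good partial permutations and covers *)

Section Permutations.

Variable n : nat.
Implicit Types (s t : 'S_n) (A B : {set 'S_n}) (S T X P : {set 'I_n * 'I_n}).

Definition graph s : {set 'I_n * 'I_n} := [set x | s x.1 == x.2].

Lemma graphE s : graph s = [set (i, s i) | i : 'I_n].
Proof.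
apply/setP => -[i j]; rewrite inE /=; apply/eqP/imsetP => [<-|[k _ [-> ->]]] //.
by exists i.
Qed.

Lemma card_graph s : #|graph s| = n.
Proof. by rewrite graphE card_imset ?card_ord // => i j []. Qed.

Lemma agree_graph s t : agree s t = #|graph s :&: graph t|.
Proof.
rewrite /agree -(card_imset _ (_ : injective (fun i => (i, s i)))); last by move=> i j [].
congr #|pred_of_set _|; apply/setP => -[i j]; rewrite !inE /=.
apply/imsetP/andP => [[k]|[/eqP <- /eqP ht]].
  by rewrite inE => /eqP st [-> ->]; rewrite st.
by exists i; rewrite // inE ht.
Qed.

(** Right multiplication by the inverse of one extension [s0] of [S] sends all extensions to
    permutations fixing the domain [D] pointwise. *)
Lemma card_coset S : (#|link graph setT S| <= (n - #|S|)`!)%N.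
Proof.
have [->|[s0]] := set_0Vmem (link graph setT S); first by rewrite cards0.
rewrite inE => /andP[_ /subsetP S0].
pose D := [set x.1 | x in S].
have cD : #|D| = #|S|.
  apply: card_in_imset => -[i j] [i' j'] /S0 + /S0; rewrite !inE /=.
  by move=> /eqP <- /eqP <- ->.
rewrite -cD (_ : n - #|D| = #|~: D|)%N; last by rewrite [RHS]cardsCs setCK card_ord.
rewrite -card_perm.
rewrite -(card_imset _ (mulIg s0^-1%g)) subset_leq_card //.
apply/subsetP => _ /imsetP[s + ->]; rewrite inE => /andP[_ /subsetP Ss].
apply/subsetP => i; rewrite !inE permM; apply: contraNN => /imsetP[x xS ->].
have := S0 _ xS; have := Ss _ xS; rewrite !inE => /eqP -> /eqP <-.
by rewrite permK.
Qed.

Lemma linkU A S X : link graph (link graph A S) X = link graph A (S :|: X).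
Proof. by apply/setP => s; rewrite !inE subUset andbA. Qed.

Variable R : realFieldType.

(* Maximise [#|A[S]| * n^_#|S| / a ^ #|S|] over [S]: the density of the link of
   [S] among the permutations extending [S], discounted by the size of [S]. *)
Lemma max_density_link (a : R) A : 0 < a -> A != set0 ->
  exists S, [/\ link graph A S != set0,
    a ^+ #|S| * #|A|%:R <= (n`!)%:R
  & forall X, [disjoint X & S] ->
      #|link graph (link graph A S) X|%:R * ((n - #|S|) ^_ #|X|)%:R
        <= a ^+ #|X| * #|link graph A S|%:R].
Proof.
move=> a0 A0.
pose w S : R := #|link graph A S|%:R * (n ^_ #|S|)%:R / a ^+ #|S|.
have [S hS] : exists S, forall X, w X <= w S.
  exists [arg max_(S > set0 | true) w S]%O.
  by case: arg_maxP => // S _ h X; apply: h.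
have w0 : w set0 = #|A|%:R.
  rewrite /w cards0 expr0 divr1 ffactn0 mulr1; congr _%:R; apply: eq_card => s.
  by rewrite inE sub0set andbT.
have ap k : 0 < a ^+ k by rewrite exprn_gt0.
have lS0 : link graph A S != set0.
  apply/eqP => lS; have := hS set0; rewrite w0 /w lS cards0 mul0r mul0r.
  by rewrite lern0 cards_eq0 (negbTE A0).
have Sn : (#|S| <= n)%N.
  case/set0Pn: lS0 => s; rewrite inE => /andP[_ /subset_leq_card].
  by rewrite card_graph.
exists S; split => //.
(* Comparison with [set0] bounds the size of [S]; comparison with [S :|: X] below gives
   spreadness. *)
- have := hS set0; rewrite w0 /w ler_pdivlMr // mulrC => h; apply: le_trans h _.
  rewrite -natrM ler_nat mulnC -(ffact_fact Sn) leq_mul2l; apply/orP; right.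
  apply: leq_trans (card_coset S); apply: subset_leq_card; apply/subsetP => s.
  by rewrite !inE => /andP[].
- move=> X dX; have := hS (S :|: X).
  rewrite /w -linkU cardsU (eqP (_ : #|S :&: X| == 0)%N) ?subn0; last first.
    by rewrite cards_eq0 setI_eq0 disjoint_sym.
  rewrite ffactnD exprD ler_pdivrMr ?mulr_gt0 // natrM.
  have nS : 0 < (n ^_ #|S|)%:R :> R by rewrite ltr0n ffact_gt0.
  have zn := lt0r_neq0 (ap #|S|).
  rewrite mulrA -[leRHS]mulrA [_^-1 * _]mulrA mulVf // mul1r.
  by rewrite [leLHS]mulrAC [leRHS]mulrAC ler_pM2r // [leRHS]mulrC.
Qed.

(** [B] may be any subfamily of the link, so an [S] found inside a subfamily of [A] is good for [A]
    itself. *)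
Definition good (r : R) q A S : bool :=
  (#|S| <= q)%N &&
  [exists B : {set 'S_n},
    [&& B \subset link graph A S, B != set0 & spread graph r B S]].

Definition uncovered r q A :=
  [set s in A | [forall S, good r q A S ==> ~~ (S \subset graph s)]].

(** Small enough that [a * a <= 103/100], yet above 1, so that [a ^+ k <= n%:R ^+ 3] keeps [k]
    logarithmic. *)
Let a : R := 101%:R / 100%:R.

(** One factor [a] undoes the division in [r]; the other absorbs the loss of [q + q + 4] from
    [n]. *)
Lemma radius_bounds q : (1000 * (q + 1) <= n)%N ->
  let r : R := (n - (q + q) - 4)%:R / a in
  [/\ 0 < r, n%:R <= a * a * r, r <= (n - (q + q) - 4)%:R
    & (q + q)%:R * 20%:R <= r].
Proof.
move=> hq /=; have h4 : (q + q + 4 <= n)%N by lia.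
have hn : 1000%:R * (q%:R + 1) <= n%:R :> R by rewrite -(natrD R q 1) -natrM ler_nat.
have q0 := ler0n R q.
rewrite -subnDA natrB // !natrD /a; move: (q%:R) (n%:R) q0 hn => x y x0 hn.
by rewrite !invf_div; split; lra.
Qed.

Lemma good_meet r q A S T :
    (1000 * (q + 1) <= n)%N -> r = (n - (q + q) - 4)%:R / a ->
    no_singleton_intersection A -> good r q A S -> good r q A T ->
  (1 < #|S :&: T|)%N.
Proof.
move=> hq -> nsA /andP[Sq /existsP[B /and3P[BA B0 sB]]].
move=> /andP[Tq /existsP[C /and3P[CA C0 sC]]].
rewrite ltnNge; apply/negP => d1.
have [r0 nr rn qr] := radius_bounds hq.
have sub (D : {set 'S_n}) X s : D \subset link graph A X -> s \in D ->
    s \in A /\ X \subset graph s.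
  by move=> /subsetP h /h; rewrite inE => /andP.
have a1 : a * a <= 103%:R / 100%:R by rewrite /a; lra.
have cU : (#|{: 'I_n * 'I_n}| <= n ^ 2)%N by rewrite card_prod card_ord.
have := @spread_meet_once _ _ graph R _ (a * a) n (q + q) B C S T r0 nr a1 cU rn qr.
case=> //.
- exact: leq_add.
- by move=> s _; apply: card_graph.
- by move=> s _; apply: card_graph.
- by move=> s /(sub _ _ _ BA)[].
- by move=> s /(sub _ _ _ CA)[].
move=> s [t [/(sub _ _ _ BA)[sA _] /(sub _ _ _ CA)[tA _]]].
by rewrite -agree_graph; apply: nsA.
Qed.

(** Were the set larger, a densest discounted link in it would give an [S] with
    [a ^+ #|S| <= n%:R ^+ 3], hence short and good for [A], although members of the set extend no
    good [S]. *)
Lemma card_uncovered r q A :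
    (1000 * (q + 1) <= n)%N -> r = (n - (q + q) - 4)%:R / a ->
    (forall k, a ^+ k <= n%:R ^+ 3 -> (k <= q)%N) ->
  (#|uncovered r q A| <= (n - 3)`!)%N.
Proof.
move=> hq -> hk; set A' := uncovered _ _ _; rewrite leqNgt; apply/negP => big.
have A'0 : A' != set0 by rewrite -card_gt0 (leq_ltn_trans _ big).
have a0 : 0 < a by rewrite divr_gt0.
have [S [lS0 cS hS]] := max_density_link a0 A'0.
have [r0 nr rn qr] := radius_bounds hq.
have Sq : (#|S| <= q)%N.
  apply: hk; have n3 : (3 <= n)%N by lia.
  have f0 : 0 < ((n - 3)`!)%:R :> R by rewrite ltr0n fact_gt0.
  rewrite -(ler_pM2r f0); apply: le_trans (_ : a ^+ #|S| * #|A'|%:R <= _).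
    by rewrite ler_wpM2l ?exprn_ge0 ?(ltW a0) // ler_nat ltnW.
  apply: le_trans cS _; rewrite -(ffact_fact n3) natrM ler_wpM2r //.
  by rewrite -natrX ler_nat ffact_le_exp.
have gS : good ((n - (q + q) - 4)%:R / a) q A S.
  rewrite /good Sq; apply/existsP; exists (link graph A' S); apply/and3P; split=> //.
    by apply/subsetP => s; rewrite !inE => /andP[/andP[-> _] ->].
  apply/forallP => X; apply/implyP => /andP[dX X4].
  rewrite expr_div_n mulrA ler_pdivrMr ?exprn_gt0 // mulrC [leRHS]mulrC.
  apply: le_trans (hS X dX); rewrite mulrC ler_wpM2l // -natrX ler_nat.
  apply: leq_trans (ffact_ge_exp _ _).
  case: #|X| X4 => // j j4; rewrite leq_exp2r //; lia.
case/set0Pn: lS0 => s; rewrite !inE => /andP[/andP[_ /forallP/(_ S)]].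
by rewrite gS /= => /negbTE ->.
Qed.

(* If no pair lies in every member of the 2-intersecting family [F], fix [T] in
   [F]: any [S] in [F] contains a pair of [T], and a point outside this pair in
   a member of [F] that does not contain the pair. *)
Lemma card_cover_no_common_pair q A (F : pred {set 'I_n * 'I_n}) :
    (forall S, F S -> (#|S| <= q)%N) ->
    (forall S T, F S -> F T -> (1 < #|S :&: T|)%N) ->
    (exists T, F T) ->
    (forall x y, x != y -> exists2 S, F S & ~~ ([set x; y] \subset S)) ->
    (forall s, s \in A -> exists2 S, F S & S \subset graph s) ->
  (#|A| <= q ^ 3 * (n - 3)`!)%N.
Proof.
move=> Fq F2 [T FT] Fno AF.
(* The default [T] makes [Fh] hold for all [x] and [y]; for distinct ones the search succeeds. *)
pose h x y := odflt T [pick S | F S && ~~ ([set x; y] \subset S)].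
have Fh x y : F (h x y) by rewrite /h; case: pickP => //= S /andP[].
have hN x y : x != y -> ~~ ([set x; y] \subset h x y).
  move=> xy; rewrite /h; case: pickP => [S /andP[]|] //= no.
  by have [S FS nS] := Fno x y xy; have := no S; rewrite FS nS.
pose C := \bigcup_(x in T) \bigcup_(y in T :\ x) \bigcup_(z in h x y :\: [set x; y])
  link graph setT [set x; y; z].
have cC : (#|C| <= q ^ 3 * (n - 3)`!)%N.
  have -> : (q ^ 3 * (n - 3)`! = q * (q * (q * (n - 3)`!)))%N.
    by rewrite !expnS expn0 muln1 !mulnA.
  apply: leq_trans (leq_card_bigcup _) (leq_mul (Fq _ FT) (leqnn _)) => x xT.
  have cTx : (#|T :\ x| <= q)%N.
    by apply: leq_trans (Fq _ FT); rewrite subset_leq_card // subsetDl.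
  apply: leq_trans (leq_card_bigcup _) (leq_mul cTx (leqnn _)) => y.
  rewrite !inE => /andP[yx yT].
  have ch : (#|h x y :\: [set x; y]| <= q)%N.
    by apply: leq_trans (Fq _ (Fh x y)); rewrite subset_leq_card // subsetDl.
  apply: leq_trans (leq_card_bigcup _) (leq_mul ch (leqnn _)) => z.
  rewrite !inE negb_or => /andP[/andP[zx zy] _].
  apply: leq_trans (card_coset _) _; rewrite setUC cardsU1 cards2 !inE negb_or zx zy.
  by rewrite eq_sym yx.
apply: leq_trans cC; apply: subset_leq_card; apply/subsetP => s /AF[S FS Ss].
have /card_gt1P[x [y [+ + xy]]] := F2 S T FS FT.
rewrite !inE => /andP[xS xT] /andP[yS yT].
(* Otherwise [S :&: h x y], having at least two elements, would equal the pair, which [h x y] does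
   not contain. *)
have [z] : exists z, z \in (S :&: h x y) :\: [set x; y].
  apply/set0Pn; rewrite setD_eq0; apply/negP => sub.
  have : S :&: h x y == [set x; y].
    by rewrite eqEcard sub cards2 xy F2.
  by move=> /eqP e; have := hN x y xy; rewrite -e subsetIr.
rewrite !inE => /andP[zxy /andP[zS zh]].
apply/bigcupP; exists x => //; apply/bigcupP; exists y.
  by rewrite !inE eq_sym xy yT.
apply/bigcupP; exists z; first by rewrite !inE zxy zh.
rewrite !inE /=; apply/subsetP => u; rewrite !inE => hu.
have : u \in S by case/orP: hu => [/orP[]|] /eqP ->.
by move/(subsetP Ss); rewrite inE.
Qed.

End Permutations.

(** * The dichotomy and the choice of constants *)

Lemma almost_contained_in_fix2 (R : realFieldType) (c : R) M n q (A : {set 'S_n}) :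
    2 < c * M%:R -> ((1000 + M) * (q + 1) ^ 3 <= n)%N ->
    (forall k, (101%:R / 100%:R) ^+ k <= n%:R ^+ 3 :> R -> (k <= q)%N) ->
    no_singleton_intersection A -> c * ((n - 2)`!)%:R <= (#|A|)%:R ->
  exists i j k l : 'I_n, i != k /\ j != l /\
    (#|A :\: fix2 A i j k l| <= (n - 3)`!)%N.
Proof.
move=> cM hn hq nsA cA.
have hq1 : (1000 * (q + 1) <= n)%N.
  apply: leq_trans hn; rewrite leq_mul ?leq_addr //.
  by rewrite -{1}(expn1 (q + 1)) leq_pexp2l // addn1.
pose r : R := (n - (q + q) - 4)%:R / (101%:R / 100%:R).
have cU := card_uncovered A hq1 (erefl r) hq.
have meet S T := @good_meet n R r q A S T hq1 erefl nsA.
(* Without good sets all of [A] is uncovered, and any 2-coset serves. *)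
case: (pickP (good r q A)) => [T gT|no]; last first.
  have n1 : (1 < n)%N by lia.
  exists (Ordinal (ltnW n1)), (Ordinal (ltnW n1)), (Ordinal n1), (Ordinal n1).
  do 2![split=> //]; apply: leq_trans cU; apply: subset_leq_card.
  apply/subsetP => s; rewrite !inE => /andP[_ ->] /=.
  by apply/forallP => S; rewrite no.
have Fq S : good r q A S -> (#|S| <= q)%N by case/andP.
case: (boolP [exists x, [exists y, (x != y) &&
   [forall S, good r q A S ==> ([set x; y] \subset S)]]]).
  case/existsP=> -[i j] /existsP[[k l]] /andP[xy /forallP allS].
  have xyS S : good r q A S -> [set (i, j); (k, l)] \subset S.
    exact/implyP/allS.
  have ijkl s : [set (i, j); (k, l)] \subset graph s -> s i = j /\ s k = l.
    move=> /subsetP h; have := h (i, j); have := h (k, l).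
    by rewrite !inE /= !eqxx orbT => /(_ isT)/eqP -> /(_ isT)/eqP ->.
  have [s [si sk]] : exists s : 'S_n, s i = j /\ s k = l.
    case/andP: (gT) => _ /existsP[B /and3P[/subsetP BA /set0Pn[s sB] _]].
    have := BA s sB; rewrite inE => /andP[_ Ts]; exists s; apply: ijkl.
    exact: subset_trans (xyS _ gT) Ts.
  have ik : i != k.
    by apply: contraNneq xy => e; rewrite -si -sk e.
  exists i, j, k, l; split=> //; split.
    by rewrite -si -sk (inj_eq perm_inj).
  apply: leq_trans cU; apply: subset_leq_card; apply/subsetP => t.
  rewrite !inE => /andP[+ tA]; rewrite tA /= => nf.
  apply/forallP => S; apply/implyP => gS; apply: contraNN nf => St.
  by have [-> ->] := ijkl t (subset_trans (xyS _ gS) St); rewrite !eqxx.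
rewrite negb_exists => /forallP nopair; exfalso.
have cover : (#|A :\: uncovered r q A| <= q ^ 3 * (n - 3)`!)%N.
  apply: (@card_cover_no_common_pair n q _ (good r q A)) => //.
  - by exists T.
  - move=> x y xy; have := nopair x; rewrite negb_exists => /forallP/(_ y).
    by rewrite xy negb_forall => /existsP[S]; rewrite negb_imply => /andP[]; exists S.
  move=> s; rewrite !inE => /andP[+ sA]; rewrite sA negb_forall => /existsP[S].
  by rewrite negb_imply negbK => /andP[]; exists S.
have : (#|A| <= (q ^ 3 + 1) * (n - 3)`!)%N.
  rewrite -(cardsID (uncovered r q A) A) mulnDl mul1n addnC leq_add //.
  by apply: leq_trans cU; rewrite subset_leq_card // subsetIr.
rewrite -(ler_nat R) => /(le_trans cA).
have n1000 : (1000 <= n)%N by lia.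
rewrite (_ : n - 2 = (n - 3).+1)%N; last by lia.
rewrite factS !natrM mulrA ler_pM2r ?ltr0n ?fact_gt0 //; apply/negP; rewrite -ltNge.
rewrite (_ : (n - 3).+1 = n - 2)%N; last by lia.
rewrite natrB; last by lia.
(* As [n - 2] is at least half of [n] and [2 < c * M%:R], this gives
   [c * (n - 2) > (q + 1) ^ 3 >= q ^ 3 + 1], the contradiction. *)
have Mq : M%:R * (q + 1)%:R ^+ 3 <= n%:R :> R.
  by rewrite -natrX -natrM ler_nat (leq_trans _ hn) // leq_mul2r leq_addl orbT.
have c0 : 0 < c.
  by rewrite ltNge; apply/negP => c0; have := mulr_le0_ge0 c0 (ler0n R M); lra.
have n4 : 4%:R <= n%:R :> R by rewrite ler_nat; lia.
have := ler_wpM2l (ltW c0) Mq; have := ler_wpM2l (ltW c0) n4.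
have q0 := ler0n R q.
have q3 : 0 < (q + 1)%:R ^+ 3 :> R by rewrite exprn_gt0 // ltr0n addn1.
have : 2 * (q + 1)%:R ^+ 3 < c * M%:R * (q + 1)%:R ^+ 3 by rewrite ltr_pM2r.
have : (q ^ 3 + 1)%:R <= (q + 1)%:R ^+ 3 :> R.
  rewrite -natrX ler_nat; lia.
lra.
Qed.

Theorem theorem4p1 (R : archiRealFieldType) (c : R) (hc : 0 < c) :
  exists K : R, 0 < K /\
    forall (n : nat) (A : {set 'S_n}), (0 < n)%N ->
      no_singleton_intersection A ->
      c * ((n - 2)`!)%:R <= (#|A|)%:R ->
      exists i j k l : 'I_n, i != k /\ j != l /\
        (#|A :\: fix2 A i j k l|)%:R <= K * ((n - 3)`!)%:R.
Proof.
have [M cM] : exists M, 2 < c * M%:R.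
  exists (Num.bound (2 / c)); rewrite mulrC -ltr_pdivrMr // archi_boundP //.
  by rewrite divr_ge0 // ltW.
(* For [q = 300 * (trunc_log 2 n + 1)], [q + 1] is at most [301 * (trunc_log 2 n + 1)]. *)
have [n0 hn0] := cube_le_of_log ((1000 + M) * 301 ^ 3).
(* Below [n0] the trivial bound [n!] on the size of [A] suffices. *)
exists (n0`!)%:R; split; first by rewrite ltr0n fact_gt0.
move=> n A n_gt0 nsA cA.
have [small|large] := ltnP n n0; last first.
  have [] := @almost_contained_in_fix2 R c M n (300 * (trunc_log 2 n + 1)) A cM _ _ nsA cA.
  - apply: leq_trans (hn0 n large); rewrite -(mulnA (1000 + M)%N) -expnMn.
    by rewrite leq_mul2l leq_exp2r //; lia.
  - exact: leq_of_growth.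
  move=> i [j [k [l [ik [jl h]]]]]; exists i, j, k, l; do 2![split=> //].
  by rewrite -natrM ler_nat (leq_trans h) // leq_pmull // fact_gt0.
(* For [n = 1] a permutation meets itself exactly once, so [A] is empty, against its positive lower
   bound. *)
have n1 : (1 < n)%N.
  rewrite ltn_neqAle n_gt0 andbT; apply/eqP => n1; subst n.
  have A0 : A = set0.
    apply/setP => s; rewrite inE; apply/negP => sA; apply: (nsA s s sA sA).
    by rewrite agree_graph setIid card_graph.
  by move: cA; rewrite A0 cards0 leNgt mulr_gt0 // ltr0n fact_gt0.
exists (Ordinal (ltnW n1)), (Ordinal (ltnW n1)), (Ordinal n1), (Ordinal n1).
do 2![split=> //]; rewrite -natrM ler_nat.
apply: (@leq_trans n0`!); last by rewrite leq_pmulr ?fact_gt0.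
apply: (leq_trans (max_card _)); rewrite card_Sn.
exact/leq_fact/ltnW.
Qed.
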